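(* Let $\{q_n\}_{n\ge 0}$ be a sequence of positive real numbers and let $1<k\le s<\infty$. Let $k^{*}$ be the conjugate index of $k$, i.e. $1/k+1/k^{*}=1$. Then $|C,1|_k\Rightarrow|\overline{N},q_n|_s$ (every series summable $|C,1|_k$ is summable $|\overline{N},q_n|_s$) if and only if both of the following hold: (i) $$\frac{n^{1+1/k-1/s}\,q_n}{Q_n}=O(1)\qquad(n\ge 1),$$ and (ii) $$\left(\sum_{n=m+1}^{\infty}\left(\frac{n^{1-1/s}q_n}{Q_nQ_{n-1}}\right)^{s}\right)^{1/s}\left(\sum_{v=1}^{m}\bigl|Q_v-(v+1)q_v\bigr|^{k^{*}}\frac1v\right)^{1/k^{*}}=O(1)\qquad(m\ge 1).$$
   Context: For a positive sequence $\{q_n\}_{n\ge0}$ put $Q_n=\sum_{i=0}^n q_i$. Given a series $\sum_{n\ge 0} a_n$ with partial sums $s_n=\sum_{i=0}^n a_i$, the $n$th term of its $(\overline{N},q_n)$ (weighted mean) transform is $T_n=\frac1{Q_n}\sum_{i=0}^n q_i s_i$. For $s>1$, the series $\sum a_n$ is called summable $|\overline{N},q_n|_s$ if $\sum_{n=1}^\infty n^{s-1}|\Delta T_n|^s<\infty$, where $\Delta T_n=T_n-T_{n-1}$. Summability $|C,1|_k$ (Cesàro of order 1) is the special case of $|\overline{N},p_n|_k$ with $p_n=1$ for all $n$, i.e. with $T_n=\frac1{n+1}\sum_{i=0}^n s_i$ and the condition $\sum_{n=1}^\infty n^{k-1}|\Delta T_n|^k<\infty$. The notation $A\Rightarrow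 B$ between summability methods means that every series summable $A$ is summable $B$. A condition ''$=O(1)$'' means the quantity is finite and bounded by a constant uniformly in the indicated free index. *)

(* Defs.v *)
From HB Require Import structures.
From mathcomp Require Import all_boot all_order all_algebra.
From mathcomp Require Import all_classical all_reals all_analysis.

Set Implicit Arguments.
Unset Strict Implicit.
Unset Printing Implicit Defensive.

Import Order.TTheory GRing.Theory Num.Theory.
Import numFieldNormedType.Exports.

Local Open Scope ring_scope.

(* Sum of the first n.+1 terms u_0, ..., u_n; library [series u n] stops at
   u_(n-1). Used both for Q_n (from q) and s_n (from a). *)
Definition psum (R : realType) (u : nat -> R) (n : nat) : R :=
  \sum_(0 <= i < n.+1) u i.

Definition wmean (R : realType) (q a : nat -> R) (n : nat) : R :=
  (psum q n)^-1 * \sum_(0 <= i < n.+1) q i * psum a i.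

(* Summability |N-bar, q_n|_s of the series with terms a. The sum of
   nonnegative terms lives in the extended reals, so [< +oo] is convergence. *)
Definition wmean_summable (R : realType) (q : nat -> R) (s : R)
    (a : nat -> R) : Prop :=
  (\sum_(1 <= n <oo)
     (n%:R `^ (s - 1) * `|wmean q a n - wmean q a n.-1| `^ s)%:E < +oo)%E.

(* Summability |C,1|_k: with q = 1, psum q n = n + 1. *)
Definition cesaro_summable (R : realType) (k : R) (a : nat -> R) : Prop :=
  wmean_summable (fun=> 1) k a.

Definition summability_implies (R : realType)
    (A B : (nat -> R) -> Prop) : Prop :=
  forall a : nat -> R, A a -> B a.

(* [0, +oo]-valued: nothing forces the series to converge for a general q. *)
Definition wmean_tail (R : realType) (q : nat -> R) (s : R) (m : nat) : \bar R :=
  (\sum_(m.+1 <= n <oo)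
     ((n%:R `^ (1 - s^-1) * q n / (psum q n * psum q n.-1)) `^ s)%:E)%E.

(* Main.v *)
Require Import Defs.
From HB Require Import structures.
From mathcomp Require Import all_boot all_order all_algebra.
From mathcomp Require Import all_classical all_reals all_analysis.
From mathcomp Require Import ring lra.

Set Implicit Arguments.
Unset Strict Implicit.
Unset Printing Implicit Defensive.

Import Order.TTheory GRing.Theory Num.Theory.
Import numFieldNormedType.Exports.

Local Open Scope ring_scope.

(** Write [D_n] for the increments of the Cesaro means, [T_n] for the weighted
means and [d_v = Q_v - (v + 1) q_v]. Expressing the terms of the series through
the [D_n] and summing by parts gives

  [T_n - T_(n-1) = (n + 1) (q_n / Q_n) D_n
                   + q_n / (Q_n Q_(n-1)) * \sum_(1 <= v < n) d_v D_v]

([wmean_diff_cesaro]). Every sequence arises as [D], so with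
[x_n = n^(1 - 1/k) D_n] and [y_n = n^(1 - 1/s) (T_n - T_(n-1))] the inclusion of
the two methods says that the matrix [x |-> y], a diagonal [e] plus a strictly
lower triangular factorable matrix [b_n c_v], maps [l^k] into [l^s]. Condition
(i) says that [e] is bounded, condition (ii) is the Muckenhoupt-type bound that
characterises the weighted Hardy inequality for [b] and [c]; the equivalence
for general [e], [b], [c] is [factorable_matrix].

Sufficiency. The diagonal part is harmless because [l^k] is contained in [l^s].
For the triangular part ([weighted_hardy]), Abel summation turns
[\sum_n b_n^s S_n^s], where [S_n = \sum_(v < n) |c_v x_v|], into a sum of tails
of [b^s] against increments of [S^s]; the bound (ii) replaces the tails by a
power of [\sum_(i <= v) |c_i|^k*], and what remains is controlled by the
inequality of Copson ([copson]) for weighted averages. That inequality is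
proved by a telescoping argument whose boundary term provides, at no cost, the
pointwise bound that reduces the exponent [s] to [k].

Necessity. A positive operator that maps the positive cone of [l^p] into [l^s]
is bounded on it ([positive_operator_bounded]): from vectors [w_j] of norm at
most 1 with larger and larger images one builds the single vector with [x^p =
\sum_j 2^-(j+1) w_j^p], which dominates a multiple of each [w_j]. For the
diagonal the signs of [x] are chosen one after the other so that the triangular
part never cancels it; testing on unit vectors yields (i). The triangular part
alone then also maps [l^k] into [l^s], and testing it on the extremal vectors
of the inequality of Hoelder, truncated at [m], yields (ii). Finiteness of the
tails in (ii) is read off from the series whose only nonzero term is [a_1 = 1].

All sequences below are indexed from 0, so that index [i] corresponds to
[n = i + 1] above. *)

(** * Inequalities for powers *)

(** For nonnegative terms this is convergence of the series. *)
Definition bounded_sums (R : realType) (u : nat -> R) : Prop :=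
  exists M : R, forall N : nat, \sum_(0 <= i < N) u i <= M.

Lemma conjugate_exponents (R : realType) (p p' : R) :
  1 < p -> p^-1 + p'^-1 = 1 ->
  [/\ 1 < p', p * p' = p + p' & (p - 1) * p' = p].
Proof.
move=> p1 pp'.
have p0 : 0 < p by lra.
have ip1 : p^-1 < 1 by rewrite invf_lt1.
have ip0 : 0 < p'^-1 by lra.
have p'0 : 0 < p' by rewrite -invr_gt0.
have E : p * p' = p + p'.
  have -> : p + p' = p * p' * (p^-1 + p'^-1) by field; rewrite !gt_eqF.
  by rewrite pp' mulr1.
split=> //; last by rewrite mulrBl E; lra.
have : 0 < p^-1 by rewrite invr_gt0.
by rewrite -[p']invrK invf_gt1 //; lra.
Qed.

(** Convexity of the power, read off from the inequality of Young applied to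
[x] and [y `^ (s - 1)]. *)
Lemma powR_sub_le (R : realType) (s x y : R) : 1 < s -> 0 <= x -> 0 <= y ->
  y `^ s - x `^ s <= s * y `^ (s - 1) * (y - x).
Proof.
move=> s1 x0 y0.
have s0 : 0 < s by lra.
pose s' := s / (s - 1).
have ss' : s^-1 + s'^-1 = 1 by rewrite /s'; field; rewrite !gt_eqF //; lra.
have [s'1 _ E] := conjugate_exponents s1 ss'.
have Y := @conjugate_powR R x (y `^ (s - 1)) s s' x0 (powR_ge0 _ _) s0 _ ss'.
have {}Y := Y ltac:(lra).
move: Y; rewrite -powRrM E => Y.
have -> : s * y `^ (s - 1) * (y - x) =
    s * (y * y `^ (s - 1)) - s * (x * y `^ (s - 1)) by ring.
rewrite mulr_powRB1 //.
have : s * (x * y `^ (s - 1)) <= s * (x `^ s / s + y `^ s / s').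
  by rewrite ler_pM2l.
have -> : s * (x `^ s / s + y `^ s / s') = x `^ s + (s - 1) * y `^ s.
  by rewrite /s'; field; rewrite !gt_eqF //; lra.
lra.
Qed.

(** * The weighted Hardy inequality *)

Lemma abel_sum (R : realType) (u F : nat -> R) (N : nat) : F 0%N = 0 ->
  \sum_(0 <= i < N) u i * F i =
  \sum_(0 <= v < N) (\sum_(v.+1 <= i < N) u i) * (F v.+1 - F v).
Proof.
move=> F0; elim: N => [|N IH]; first by rewrite !big_nil.
rewrite big_nat_recr //= IH [RHS]big_nat_recr //=.
rewrite [X in _ = _ + X * _]big_geq // mul0r addr0.
have -> : u N * F N = \sum_(0 <= v < N) u N * (F v.+1 - F v).
  by rewrite -mulr_sumr telescope_sumr // F0 subr0.
rewrite -big_split /=; apply: eq_big_nat => v /andP[_ vN].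
by rewrite [in RHS]big_nat_recr //= mulrDl.
Qed.

(** Here [C] is the total weight so far, [c] the next weight, [A] and [B] are
the weighted averages of [g] before and after. Multiplying the relation between
them by [p' * B `^ (p - 1)] and applying the inequality of Young to both
products [A * B `^ (p - 1)] and [p' * g * B `^ (p - 1)] gives the estimate in a
form that telescopes (Elliott's proof of the Hardy inequality). *)
Lemma copson_step (R : realType) (p p' C c A B g : R) :
  1 < p -> p^-1 + p'^-1 = 1 -> 0 <= C -> 0 <= c -> 0 <= A -> 0 <= B -> 0 <= g ->
  (C + c) * B = C * A + c * g ->
  (p' - 1) * ((C + c) * B `^ p) + p^-1 * (c * B `^ p)
  <= (p' - 1) * (C * A `^ p) + p' `^ p / p * (c * g `^ p).
Proof.
move=> p1 pp' C0 c0 A0 B0 g0 E.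
have [p'1 pp'E pp'F] := conjugate_exponents p1 pp'.
have p0 : 0 < p by lra.
have p'0 : 0 < p' by lra.
pose t := B `^ (p - 1).
have tE : t `^ p' = B `^ p by rewrite -powRrM pp'F.
have t0 : 0 <= t := powR_ge0 _ _.
have Y1 : A * t <= A `^ p / p + B `^ p / p'.
  by rewrite -tE; apply: conjugate_powR.
have Y2 : p' * g * t <= p' `^ p * g `^ p / p + B `^ p / p'.
  rewrite -tE -powRM //; last lra.
  by apply: conjugate_powR => //; apply: mulr_ge0; lra.
have P0 : B * t = B `^ p by rewrite mulr_powRB1.
have Q : p' * ((C + c) * B `^ p) = p' * C * (A * t) + c * (p' * g * t).
  by rewrite -P0; transitivity (p' * ((C + c) * B) * t); [ring|rewrite E; ring].
have {}Y1 : p' * C * (A * t) <= p' * C * (A `^ p / p + B `^ p / p').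
  by apply: ler_wpM2l => //; apply: mulr_ge0; lra.
have {}Y2 : c * (p' * g * t) <= c * (p' `^ p * g `^ p / p + B `^ p / p').
  exact: ler_wpM2l.
have I1 : p' / p = p' - 1.
  by apply: (@mulIf _ p); rewrite ?mulfVK ?gt_eqF //; lra.
have I2 : p'^-1 = 1 - p^-1 by lra.
have E1 : p' * C * (A `^ p / p + B `^ p / p') =
    (p' / p) * (C * A `^ p) + (p' / p') * (C * B `^ p).
  by ring.
rewrite E1 I1 divff ?gt_eqF // mul1r in Y1.
rewrite I2 in Y2.
have E3 : p' `^ p / p * (c * g `^ p) = c * (p' `^ p * g `^ p / p) by ring.
rewrite E3; rewrite mulrDr in Y2.
have E4 : c * (B `^ p * (1 - p^-1)) = c * B `^ p - p^-1 * (c * B `^ p) by ring.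
rewrite E4 in Y2.
nra.
Qed.

(** Besides the weighted sum of the averages [A] that the inequality of Copson
bounds, the boundary term [psum c N * A N `^ p] of the telescoping is kept on
the left: it is the only pointwise information used in [weighted_hardy]. *)
Lemma copson (R : realType) (p p' : R) (c g : nat -> R) (N : nat)
  (A := fun n => (\sum_(0 <= i < n.+1) c i * g i) / psum c n) :
  1 < p -> p^-1 + p'^-1 = 1 ->
  (forall i, 0 <= c i) -> (forall i, 0 <= g i) ->
  (p' - 1) * (psum c N * A N `^ p) +
    p^-1 * (\sum_(0 <= i < N.+1) c i * A i `^ p)
  <= p' `^ p / p * \sum_(0 <= i < N.+1) c i * g i `^ p.
Proof.
move=> p1 pp' c0 g0.
have p0 : p != 0 by rewrite gt_eqF //; lra.
have C0 n : 0 <= psum c n by apply: sumr_ge0.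
have A0 n : 0 <= A n.
  by apply: divr_ge0 => //; apply: sumr_ge0 => i _; apply: mulr_ge0.
(* When the total weight vanishes, [A n] is 0 by the convention on division and
   the numerator vanishes as well. *)
have CA n : psum c n * A n = \sum_(0 <= i < n.+1) c i * g i.
  have [Cn|Cn] := eqVneq (psum c n) 0; last by rewrite /A mulrC divfK.
  have cz i : (0 <= i < n.+1)%N -> c i = 0.
    move=> /andP[_ iN]; apply/eqP; rewrite eq_le c0 andbT -Cn /psum.
    by rewrite (bigD1_seq i) ?mem_index_iota ?iota_uniq //= lerDl sumr_ge0.
  rewrite Cn mul0r big_nat_cond big1 // => i /andP[iN _].
  by rewrite cz // mul0r.
elim: N => [|N IH].
  rewrite /psum !big_nat1.
  have := @copson_step R p p' 0 (c 0%N) 0 (A 0%N) (g 0%N) p1 pp'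
    (lexx _) (c0 _) (lexx _) (A0 _) (g0 _).
  rewrite !add0r !mul0r mulr0 !add0r; apply.
  by have := CA 0%N; rewrite /psum !big_nat1.
have E n : psum c n.+1 = psum c n + c n.+1 by rewrite /psum big_nat_recr.
rewrite E big_nat_recr //= [in X in _ <= X]big_nat_recr //= !mulrDr.
have := @copson_step R p p' (psum c N) (c N.+1) (A N) (A N.+1) (g N.+1) p1 pp'
  (C0 _) (c0 _) (A0 _) (A0 _) (g0 _).
rewrite -E CA CA big_nat_recr //= => /(_ erefl).
rewrite E; lra.
Qed.

(** In terms of [S n], the sum of the first [n] products [c v * g v], and of the
averages [A v], where [S v.+1 = psum c v * A v], the hypothesis on [K] turns the
summand [(\sum_(i > v) u i) * s * S v.+1 `^ (s - 1) * c v * g v] produced by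
Abel summation into a multiple of
[(psum c v * A v `^ p) `^ (s / p - 1) * A v `^ (p - 1) * c v * g v].
Its first factor is bounded and the rest is summable by the inequality of Young,
both thanks to [copson]. *)
Lemma weighted_hardy (R : realType) (p p' s K G : R) (u c g : nat -> R) :
  1 < p -> p <= s -> p^-1 + p'^-1 = 1 ->
  (forall i, 0 <= u i) -> (forall i, 0 <= c i) -> (forall i, 0 <= g i) ->
  (forall m N, (\sum_(m.+1 <= i < N) u i) * psum c m `^ (s / p') <= K) ->
  (forall N, \sum_(0 <= i < N) c i * g i `^ p <= G) ->
  bounded_sums (fun i => u i * (\sum_(0 <= v < i) c v * g v) `^ s).
Proof.
move=> p1 ps pp' u0 c0 g0 HK HG.
have [p'1 pp'E pp'F] := conjugate_exponents p1 pp'.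
have p0 : 0 < p by lra.
have s0 : 0 < s by lra.
have s1 : 1 < s by lra.
pose S n := \sum_(0 <= v < n) c v * g v.
pose A n := S n.+1 / psum c n.
have S0 n : 0 <= S n by apply: sumr_ge0 => i _; apply: mulr_ge0.
have SS n : S n.+1 = S n + c n * g n by rewrite /S big_nat_recr.
have C0 n : 0 <= psum c n by apply: sumr_ge0.
have A0 n : 0 <= A n by apply: divr_ge0.
pose L := p' `^ p / p * G.
have L0 : 0 <= p' `^ p / p by apply: divr_ge0; [exact: powR_ge0|lra].
have cop N : (p' - 1) * (psum c N * A N `^ p) +
    p^-1 * (\sum_(0 <= i < N.+1) c i * A i `^ p) <= L.
  apply: (le_trans (copson N p1 pp' c0 g0)).
  exact: ler_wpM2l.
have ip0 : 0 < p^-1 by rewrite invr_gt0.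
have sA0 N : 0 <= \sum_(0 <= i < N) c i * A i `^ p.
  by apply: sumr_ge0 => i _; apply: mulr_ge0 => //; exact: powR_ge0.
have CA0 N : 0 <= psum c N * A N `^ p by apply: mulr_ge0 => //; exact: powR_ge0.
have bC N : psum c N * A N `^ p <= L / (p' - 1).
  rewrite ler_pdivlMr; last lra.
  have := cop N; have := mulr_ge0 (ltW ip0) (sA0 N.+1); lra.
have bA N : \sum_(0 <= i < N) c i * A i `^ p <= p * L.
  case: N => [|N].
    rewrite big_nil; apply: mulr_ge0; first lra.
    apply: le_trans (cop 0%N).
    by apply: addr_ge0; apply: mulr_ge0 => //; lra.
  rewrite -ler_pdivrMl //.
  have : 0 <= (p' - 1) * (psum c N * A N `^ p) by apply: mulr_ge0 => //; lra.
  have := cop N; lra.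
have K0 : 0 <= K by have := HK 0%N 0%N; rewrite big_geq // mul0r.
(* [P] is the bound for the factor [(psum c v * A v `^ p) `^ (s / p - 1)]. *)
pose P := (L / (p' - 1)) `^ (s / p - 1).
have sp : 0 <= s / p - 1 by rewrite subr_ge0 ler_pdivlMr // mul1r.
have key v N : (\sum_(v.+1 <= i < N) u i) * (S v.+1 `^ s - S v `^ s) <=
    s * (K * P) * (c v * (g v `^ p / p + A v `^ p / p')).
  have [Cv|Cv] := eqVneq (psum c v) 0.
    have cv : c v = 0.
      apply/eqP; rewrite eq_le c0 andbT -Cv /psum.
      by rewrite big_nat_recr //= lerDr sumr_ge0.
    by rewrite SS cv !mul0r addr0 subrr !mulr0.
  have Cp : 0 < psum c v by rewrite lt_neqAle eq_sym Cv C0.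
  have SE : S v.+1 = psum c v * A v by rewrite /A mulrC divfK.
  have U0 : 0 <= \sum_(v.+1 <= i < N) u i by apply: sumr_ge0.
  have D : S v.+1 - S v = c v * g v by rewrite SS addrAC subrr add0r.
  apply: (@le_trans _ _ ((\sum_(v.+1 <= i < N) u i) *
      (s * S v.+1 `^ (s - 1) * (c v * g v)))).
    by rewrite -D; apply: ler_wpM2l => //; exact: powR_sub_le.
  have B1 : (\sum_(v.+1 <= i < N) u i) * S v.+1 `^ (s - 1) <=
      K * P * A v `^ (p - 1).
    have Ub : \sum_(v.+1 <= i < N) u i <= K * psum c v `^ (- (s / p')).
      by rewrite powRN ler_pdivlMr ?powR_gt0.
    apply: (le_trans (ler_wpM2r (powR_ge0 _ _) Ub)).
    rewrite -!mulrA; apply: ler_wpM2l => //.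
    rewrite SE powRM // mulrA -powRD; last by rewrite Cv implybT.
    have -> : - (s / p') + (s - 1) = s / p - 1.
      have -> : p'^-1 = 1 - p^-1 by lra.
      by ring.
    have [Az|Az] := eqVneq (A v) 0.
      by rewrite Az !powR0 ?mulr0 // gt_eqF //; lra.
    have -> : A v `^ (s - 1) = (A v `^ p) `^ (s / p - 1) * A v `^ (p - 1).
      rewrite -powRrM -powRD; last by rewrite Az implybT.
      by congr (_ `^ _); field; rewrite gt_eqF.
    rewrite mulrA -powRM ?powR_ge0 //.
    apply: ler_wpM2r; first exact: powR_ge0.
    have La : 0 <= L / (p' - 1) := le_trans (CA0 v) (bC v).
    by apply: ge0_ler_powR; rewrite ?nnegrE.
  have Y : g v * A v `^ (p - 1) <= g v `^ p / p + A v `^ p / p'.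
    have -> : A v `^ p = (A v `^ (p - 1)) `^ p' by rewrite -powRrM pp'F.
    by apply: conjugate_powR; rewrite ?powR_ge0 //; lra.
  have cg0 : 0 <= s * (c v * g v) by apply: mulr_ge0; [lra|exact: mulr_ge0].
  have := ler_wpM2r cg0 B1.
  have : s * (K * P) * (c v * (g v * A v `^ (p - 1))) <=
      s * (K * P) * (c v * (g v `^ p / p + A v `^ p / p')).
    apply: ler_wpM2l; last exact: ler_wpM2l.
    by apply: mulr_ge0; [lra|apply: mulr_ge0 => //; exact: powR_ge0].
  rewrite [_ * (s * _ * _)](_ : _ = (\sum_(v.+1 <= i < N) u i) *
    S v.+1 `^ (s - 1) * (s * (c v * g v))); last by ring.
  rewrite [s * (K * P) * (c v * (g v * _))](_ : _ = K * P * A v `^ (p - 1) *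
    (s * (c v * g v))); last by ring.
  by move=> X Z; exact: le_trans Z X.
exists (s * (K * P) * (G / p + p * L / p')) => N.
rewrite (abel_sum u (F := fun i => S i `^ s)); last first.
  by rewrite /S big_nil powR0 // gt_eqF.
apply: (@le_trans _ _ (\sum_(0 <= v < N) s * (K * P) *
    (c v * (g v `^ p / p + A v `^ p / p')))).
  by apply: ler_sum => v _; exact: key.
rewrite -mulr_sumr; apply: ler_wpM2l.
  by apply: mulr_ge0; [lra|apply: mulr_ge0 => //; exact: powR_ge0].
under eq_bigr => v _ do rewrite mulrDr !mulrA.
rewrite big_split /= -!mulr_suml; apply: lerD; apply: ler_wpM2r => //.
  exact: ltW.
by rewrite invr_ge0; lra.
Qed.

(** * Positive operators between sequence spaces are bounded *)

(** The witness is [x i = (\sum_j 2^-(j+1) * w j i `^ p) `^ p^-1]: summing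
[p]-th powers keeps the norm at most 1 without the triangle inequality of
[l^p], and [2^-(j+1) <= (2^-(j+1)) `^ p^-1] gives the domination. *)
Lemma lp_majorant (R : realType) (p : R) (w : nat -> nat -> R) : 1 <= p ->
  (forall j i, 0 <= w j i) ->
  (forall j N, \sum_(0 <= i < N) w j i `^ p <= 1) ->
  exists x : nat -> R, [/\ forall i, 0 <= x i,
    bounded_sums (fun i => x i `^ p) &
    forall j i, 2^-1 ^+ j.+1 * w j i <= x i].
Proof.
move=> p1 w0 w1.
have p0 : 0 < p by lra.
pose h j : R := 2^-1 ^+ j.+1.
have h0 j : 0 <= h j by apply: exprn_ge0; lra.
have hs J : \sum_(0 <= j < J) h j <= 1.
  have -> : \sum_(0 <= j < J) h j = 1 - 2^-1 ^+ J.
    elim: J => [|J IH]; first by rewrite big_nil expr0 subrr.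
    by rewrite big_nat_recr //= IH /h exprS; field.
  by rewrite gerBl; apply: exprn_ge0; lra.
have wp0 j i : 0 <= w j i `^ p := powR_ge0 _ _.
have wp1 j i : w j i `^ p <= 1.
  apply: le_trans (w1 j i.+1).
  by rewrite big_nat_recr //= lerDr sumr_ge0.
pose Y i J := \sum_(0 <= j < J) h j * w j i `^ p.
have Yle i J : Y i J <= 1.
  apply: le_trans (hs J); apply: ler_sum => j _.
  by rewrite -[leRHS]mulr1; apply: ler_wpM2l.
have Yhomo i : {homo Y i : n m / (n <= m)%N >-> n <= m}.
  move=> n m nm; rewrite /Y (@big_cat_nat _ _ _ n 0 m) //= lerDl.
  by apply: sumr_ge0 => j _; exact: mulr_ge0.
have Ycvg i : cvgn (Y i).
  apply: nondecreasing_is_cvgn => //.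
  by exists 1 => _ [J _ <-].
pose y i := limn (Y i).
have Yy i J : Y i J <= y i by exact: nondecreasing_cvgn_le.
have y0 i : 0 <= y i by apply: le_trans (Yy i 0%N); rewrite /Y big_nil.
have ip : p^-1 != 0 by rewrite invr_eq0 gt_eqF.
exists (fun i => y i `^ p^-1); split.
- by move=> i; exact: powR_ge0.
- exists 1 => N.
  under eq_bigr => i _ do rewrite -powRrM mulVf ?gt_eqF // powRr1 //.
  have C : (\sum_(0 <= i < N) Y i J @[J --> \oo] -->
      \sum_(0 <= i < N) y i)%classic.
    by apply: cvg_big => [|i _]; [exact: add_continuous|exact: Ycvg].
  rewrite -(cvg_lim (@Rhausdorff R) C); apply: limr_le.
    by apply/cvg_ex; eexists; exact: C.
  apply: nearW => J; rewrite /Y exchange_big /=.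
  apply: le_trans (hs J); apply: ler_sum => j _.
  by rewrite -mulr_sumr -[leRHS]mulr1; apply: ler_wpM2l.
- move=> j i.
  have H : h j * w j i `^ p <= y i.
    apply: le_trans (Yy i j.+1); rewrite /Y big_nat_recr //= lerDr.
    by apply: sumr_ge0 => l _; exact: mulr_ge0.
  have hj : 0 < h j <= 1.
    by apply/andP; split; [apply: exprn_gt0; lra|apply: exprn_ile1; lra].
  have <- : (w j i `^ p) `^ p^-1 = w j i.
    by rewrite -powRrM mulfV ?gt_eqF // powRr1.
  apply: (@le_trans _ _ ((h j * w j i `^ p) `^ p^-1)).
    rewrite powRM //; apply: ler_wpM2r; first exact: powR_ge0.
    by apply: ger1_powR => //; rewrite invf_le1.
  by apply: ge0_ler_powR; rewrite ?nnegrE ?invr_ge0 ?mulr_ge0 //; lra.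
Qed.

(** The hypothesis relating [V w] and [V x] combines monotonicity and
homogeneity of [V]. If no bound exists, vectors [w j] of norm at most 1
are chosen whose images are so large that they stay unbounded after the loss of
the factor [2^-(j+1)] in [lp_majorant]; the image of the majorant is then not
[s]-summable. *)
Lemma positive_operator_bounded (R : realType) (p s : R)
    (V : (nat -> R) -> nat -> R) :
  1 <= p -> 0 < s ->
  (forall w i, (forall v, 0 <= w v) -> 0 <= V w i) ->
  (forall t w x i, 0 <= t -> (forall v, 0 <= w v) ->
     (forall v, t * w v <= x v) -> t * V w i <= V x i) ->
  (forall x, (forall v, 0 <= x v) -> bounded_sums (fun i => x i `^ p) ->
     bounded_sums (fun i => V x i `^ s)) ->
  exists M : R, forall w, (forall v, 0 <= w v) ->
    (forall N, \sum_(0 <= i < N) w i `^ p <= 1) ->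
    forall N, \sum_(0 <= i < N) V w i `^ s <= M.
Proof.
move=> p1 s0 V0 Vle Vb; apply: contrapT => /forallNP H.
have {}H : forall j : nat, exists wN : (nat -> R) * nat,
    [/\ forall v, 0 <= wN.1 v, forall N, \sum_(0 <= i < N) wN.1 i `^ p <= 1 &
     (2 ^+ j.+1) `^ s * j%:R < \sum_(0 <= i < wN.2) V wN.1 i `^ s].
  move=> j; have := H ((2 ^+ j.+1) `^ s * j%:R).
  move/existsNP => [w /not_implyP[w0 /not_implyP[w1 /existsNP[N /negP]]]].
  by rewrite -ltNge => wN; exists (w, N).
have [wN HwN] := choice H.
have [x [x0 xp xw]] := @lp_majorant R p (fun j => (wN j).1) p1
  (fun j => let: And3 a _ _ := HwN j in a)
  (fun j => let: And3 _ a _ := HwN j in a).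
have [M HM] := Vb x x0 xp.
have M0 : 0 <= M by have := HM 0%N; rewrite big_nil.
pose j := Num.bound M.
have Mj : M < j%:R := archi_boundP M0.
have [wj0 _] := HwN j; set w := (wN j).1 in wj0 *; set N := (wN j).2 => wj.
have h2 : 0 < 2^-1 ^+ j.+1 :> R by apply: exprn_gt0; lra.
have : j%:R < M; last by rewrite ltNge ltW.
apply: lt_le_trans (HM N).
apply: (@lt_le_trans _ _ ((2^-1 ^+ j.+1) `^ s * \sum_(0 <= i < N) V w i `^ s)).
  rewrite -ltr_pdivrMl ?powR_gt0 //; congr (_ < _) : wj.
  have E : (2 ^+ j.+1 : R) = (2^-1 ^+ j.+1)^-1 by rewrite -exprVn invrK.
  by rewrite E -[_^-1]powR_inv1 ?ltW // -!powRrM mulN1r powRN.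
rewrite mulr_sumr; apply: ler_sum => i _.
rewrite -powRM; [|exact: ltW|exact: V0].
have le : 2^-1 ^+ j.+1 * V w i <= V x i by apply: Vle => //; exact: ltW.
have V0i : 0 <= 2^-1 ^+ j.+1 * V w i by apply: mulr_ge0; [exact: ltW|exact: V0].
by apply: ge0_ler_powR; rewrite ?nnegrE ?(le_trans V0i le) //; exact: ltW.
Qed.

(** * Diagonal plus factorable matrices *)

Lemma bounded_sums_le (R : realType) (k : R) (u v w : nat -> R) : 0 <= k ->
  (forall i, u i <= k * (v i + w i)) ->
  bounded_sums v -> bounded_sums w -> bounded_sums u.
Proof.
move=> k0 le [M HM] [M' HM']; exists (k * (M + M')) => N.
apply: (@le_trans _ _ (\sum_(0 <= i < N) k * (v i + w i))).
  by apply: ler_sum => i _.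
by rewrite -mulr_sumr big_split /=; apply: ler_wpM2l => //; exact: lerD.
Qed.

Lemma bounded_sums_scale (R : realType) (k : R) (u v : nat -> R) : 0 <= k ->
  (forall i, u i <= k * v i) -> bounded_sums v -> bounded_sums u.
Proof.
move=> k0 le [M HM]; exists (k * M) => N.
apply: (@le_trans _ _ (\sum_(0 <= i < N) k * v i)).
  by apply: ler_sum => i _.
by rewrite -mulr_sumr; apply: ler_wpM2l.
Qed.

Lemma ler_powR_base (R : realType) (s x y : R) : 0 <= s -> 0 <= x -> x <= y ->
  x `^ s <= y `^ s.
Proof.
by move=> s0 x0 xy; apply: ge0_ler_powR; rewrite ?nnegrE ?(le_trans x0 xy).
Qed.

Lemma normD_powR_le (R : realType) (s x y : R) : 0 <= s ->
  `|x + y| `^ s <= 2 `^ s * (`|x| `^ s + `|y| `^ s).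
Proof.
move=> s0.
wlog xy : x y / `|x| <= `|y|.
  move=> W; have [|/ltW] := leP `|x| `|y|; first exact: W.
  by move=> /W; rewrite addrC [X in _ * X]addrC.
apply: (@le_trans _ _ ((2 * `|y|) `^ s)).
  by apply: ler_powR_base => //; apply: le_trans (ler_normD _ _) _; lra.
by rewrite powRM //; apply: ler_wpM2l; rewrite ?powR_ge0 // lerDr powR_ge0.
Qed.

Lemma lp_sub_ls (R : realType) (p s : R) (x : nat -> R) : 0 < p -> p <= s ->
  bounded_sums (fun i => `|x i| `^ p) -> bounded_sums (fun i => `|x i| `^ s).
Proof.
move=> p0 ps [M HM].
apply: (@bounded_sums_scale _ (M `^ (s / p - 1)) _ (fun i => `|x i| `^ p)).
- exact: powR_ge0.
- move=> i; have xM : `|x i| `^ p <= M.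
    apply: le_trans (HM i.+1); rewrite big_nat_recr //= lerDr.
    by apply: sumr_ge0 => j _; exact: powR_ge0.
  have sp : 0 <= s / p - 1 by rewrite subr_ge0 ler_pdivlMr // mul1r.
  have -> : `|x i| `^ s = `|x i| `^ p * (`|x i| `^ p) `^ (s / p - 1).
    rewrite -powRrM -powRD; first by congr (_ `^ _); field; rewrite gt_eqF.
    rewrite (_ : p + _ = s); last by field; rewrite gt_eqF.
    by rewrite gt_eqF //; lra.
  rewrite mulrC; apply: ler_wpM2r; rewrite ?powR_ge0 //.
  by apply: ler_powR_base; rewrite ?powR_ge0.
- by exists M.
Qed.

(** The signs are chosen recursively: [x i] takes the sign of the sum over the
preceding indices, so that it never cancels against that sum. *)
Lemma sign_alignment (R : realType) (c w : nat -> R) : (forall i, 0 <= w i) ->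
  exists x : nat -> R, forall i, `|x i| = w i /\
    0 <= x i * \sum_(0 <= v < i) c v * x v.
Proof.
move=> w0.
pose sg (r : R) : R := if 0 <= r then 1 else -1.
pose S := fix S n := if n is m.+1 then S m + c m * (sg (S m) * w m) else 0 : R.
exists (fun i => sg (S i) * w i) => i.
have -> : \sum_(0 <= v < i) c v * (sg (S v) * w v) = S i.
  by elim: i => [|i IH]; [rewrite big_nil|rewrite big_nat_recr //= IH].
rewrite normrM (ger0_norm (w0 i)) mulrAC /sg.
case: (leP 0 (S i)) => S0.
  by rewrite normr1 !mul1r; split => //; exact: mulr_ge0.
by rewrite normrN1 mul1r mulN1r; split => //; apply: mulr_ge0 => //; lra.
Qed.

Section FactorableMatrix.
Variables (R : realType) (p p' s : R) (e b c : nat -> R).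
Hypotheses (p_gt1 : 1 < p) (p_le_s : p <= s) (pp' : p^-1 + p'^-1 = 1).
Hypotheses (e_ge0 : forall i, 0 <= e i) (b_ge0 : forall i, 0 <= b i).

Let s_gt0 : 0 < s. Proof. by move: p_gt1 p_le_s; lra. Qed.
Let p_gt0 : 0 < p. Proof. by move: p_gt1; lra. Qed.

Definition maps_lp_to_ls (T : (nat -> R) -> nat -> R) : Prop :=
  forall x, bounded_sums (fun i => `|x i| `^ p) ->
    bounded_sums (fun i => `|T x i| `^ s).

Definition hardy_bound : Prop := exists K : R, forall m N : nat,
  (\sum_(m.+1 <= i < N) b i `^ s) *
    psum (fun v => `|c v| `^ p') m `^ (s / p') <= K.

Lemma diagonal_bounded C : (forall i, e i <= C) ->
  maps_lp_to_ls (fun x i => e i * x i).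
Proof.
move=> eC x xp; have xs := lp_sub_ls p_gt0 p_le_s xp.
apply: (bounded_sums_scale (k := C `^ s) _ _ xs); first exact: powR_ge0.
move=> i; rewrite normrM powRM // (ger0_norm (e_ge0 i)).
apply: ler_wpM2r; first exact: powR_ge0.
by apply: ler_powR_base => //; exact: ltW.
Qed.

(** With weights [ga = |c| `^ p'] and [g] determined by [ga * g = |c * x|], one
has [ga * g `^ p <= |x| `^ p], so [weighted_hardy] applies. *)
Lemma hardy_bounded : hardy_bound ->
  maps_lp_to_ls (fun x i => b i * \sum_(0 <= v < i) c v * x v).
Proof.
move=> [K HK] x [G HG].
have [p'1 pp'E pp'F] := conjugate_exponents p_gt1 pp'.
pose ga v := `|c v| `^ p'.
pose g v := `|x v| * `|c v| `^ (1 - p').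
have gE v : ga v * g v = `|c v| * `|x v|.
  rewrite /ga /g; have [->|cv] := eqVneq (c v) 0.
    by rewrite normr0 powR0 ?mul0r // gt_eqF //; lra.
  rewrite mulrCA -powRD; last by rewrite normr_eq0 cv implybT.
  by rewrite addrC subrK powRr1 // mulrC.
have gp v : ga v * g v `^ p <= `|x v| `^ p.
  rewrite /ga /g; have [->|cv] := eqVneq (c v) 0.
    by rewrite normr0 powR0 ?mul0r ?powR_ge0 // gt_eqF //; lra.
  rewrite powRM ?powR_ge0 // -powRrM mulrCA -powRD; last first.
    by rewrite normr_eq0 cv implybT.
  rewrite (_ : p' + _ = 0) ?powRr0 ?mulr1 //.
  by rewrite mulrBl [p' * p]mulrC pp'E; ring.
have ga0 v : 0 <= ga v by exact: powR_ge0.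
have g0 v : 0 <= g v by apply: mulr_ge0 => //; exact: powR_ge0.
have HG' N : \sum_(0 <= i < N) ga i * g i `^ p <= G.
  by apply: le_trans (HG N); apply: ler_sum => i _.
have H := weighted_hardy p_gt1 p_le_s pp' (u := fun i => b i `^ s)
  (fun i => powR_ge0 _ _) ga0 g0 HK HG'.
apply: bounded_sums_scale H; first exact: ler01.
move=> i; rewrite mul1r normrM powRM // (ger0_norm (b_ge0 i)).
apply: ler_wpM2l; first exact: powR_ge0.
apply: ler_powR_base => //; first exact: ltW.
apply: le_trans (ler_norm_sum _ _ _) _.
by under eq_bigr => v _ do rewrite normrM -gE.
Qed.

(** With the signs of [sign_alignment], the diagonal and the triangular part of
the image agree in sign, so the image dominates the diagonal part [e i * w i];
this makes the positive diagonal operator map into [l^s]. *)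
Lemma diagonal_necessary :
  maps_lp_to_ls (fun x i => e i * x i + b i * \sum_(0 <= v < i) c v * x v) ->
  exists C, forall i, e i <= C.
Proof.
move=> T.
have [|||M HM] := @positive_operator_bounded R p s (fun w i => e i * w i)
  (ltW p_gt1) s_gt0.
- by move=> w i w0; exact: mulr_ge0.
- by move=> t w x i t0 w0 wx; rewrite mulrCA; exact: ler_wpM2l.
- move=> w w0 wp.
  have [x Hx] := sign_alignment c w0.
  have xp : bounded_sums (fun i => `|x i| `^ p).
    case: wp => M HM; exists M => N.
    by under eq_bigr => i _ do rewrite (Hx i).1.
  apply: bounded_sums_scale (T x xp); first exact: ler01.
  move=> i; rewrite mul1r.
  have [xw xS] := Hx i.
  apply: ler_powR_base; [exact: ltW|exact: mulr_ge0|].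
  have -> : e i * w i = `|e i * x i| by rewrite normrM (ger0_norm (e_ge0 i)) xw.
  set S := \sum_(_ <= _ < _) _ in xS *.
  have : 0 <= (e i * x i) * (b i * S).
    by rewrite mulrACA; apply: mulr_ge0 => //; exact: mulr_ge0.
  move: (e i * x i) (b i * S) => y z yz.
  rewrite -(@ler_pXn2r _ 2) ?nnegrE // !real_normK ?num_real //.
  rewrite sqrrD -addrA lerDl.
  by apply: addr_ge0; rewrite ?sqr_ge0 // mulrn_wge0.
exists (M `^ s^-1) => i.
(* Testing on the unit vector supported at [i]. *)
pose w j : R := (j == i)%:R.
have pn0 : p != 0 by rewrite gt_eqF.
have ws N : \sum_(0 <= j < N) w j `^ p <= 1.
  rewrite /w; elim: N => [|N IH]; first by rewrite big_nil ler01.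
  have [Ni|Ni] := leqP N i.
    rewrite big_nat_recr //= big_nat_cond big1 ?add0r.
      by case: eqP => _; rewrite ?powR1 ?powR0 ?ler01.
    move=> j /andP[/andP[_ jN] _]; rewrite ltn_eqF ?powR0 //.
    exact: leq_trans jN Ni.
  by rewrite big_nat_recr //= gtn_eqF // powR0 // addr0.
have := HM w (fun v => ler0n _ _) ws i.+1.
rewrite big_nat_recr //= {2}/w eqxx mulr1 => le.
have ei : e i `^ s <= M.
  by apply: le_trans le; rewrite lerDr; apply: sumr_ge0 => j _; exact: powR_ge0.
have -> : e i = (e i `^ s) `^ s^-1 by rewrite -powRrM mulfV ?powRr1 // gt_eqF.
by apply: ler_powR_base; rewrite ?powR_ge0 // invr_ge0 ltW.
Qed.

(** Giving [x] the signs of [c] reduces the claim to the positive operator with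
entries [b i * |c v|], which is bounded. It is then tested on the normalised
truncation of [|c| `^ (p' / p)], the case of equality in the inequality of
Hoelder for [\sum_(v <= m) |c v| * w v]. *)
Lemma hardy_necessary :
  maps_lp_to_ls (fun x i => b i * \sum_(0 <= v < i) c v * x v) -> hardy_bound.
Proof.
move=> T.
have [p'1 pp'E pp'F] := conjugate_exponents p_gt1 pp'.
have [|||M HM] := @positive_operator_bounded R p s
  (fun w i => b i * \sum_(0 <= v < i) `|c v| * w v) (ltW p_gt1) s_gt0.
- move=> w i w0; apply: mulr_ge0 => //.
  by apply: sumr_ge0 => v _; exact: mulr_ge0.
- move=> t w x i t0 w0 wx; rewrite mulrCA; apply: ler_wpM2l => //.
  rewrite mulr_sumr; apply: ler_sum => v _.
  by rewrite mulrCA; exact: ler_wpM2l.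
- move=> w w0 wp.
  pose x v := Num.sg (c v) * w v.
  have xp : bounded_sums (fun i => `|x i| `^ p).
    apply: bounded_sums_scale wp; first exact: ler01.
    move=> i; rewrite mul1r; apply: ler_powR_base => //; first exact: ltW.
    rewrite /x normrM (ger0_norm (w0 i)) normr_sg.
    by case: eqP => _; rewrite ?mul1r ?mul0r.
  apply: bounded_sums_scale (T x xp); first exact: ler01.
  move=> i; rewrite mul1r.
  have -> : \sum_(0 <= v < i) c v * x v = \sum_(0 <= v < i) `|c v| * w v.
    by apply: eq_bigr => v _; rewrite /x mulrA [c v * _]mulrC -normrEsg.
  by rewrite ger0_norm // mulr_ge0 //; apply: sumr_ge0 => v _; exact: mulr_ge0.
exists M => m N.
pose ga v := `|c v| `^ p'.
have ga0 v : 0 <= ga v := powR_ge0 _ _.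
have M0 : 0 <= M.
  have := HM (fun=> 0) (fun=> lexx 0) _ 0%N; rewrite big_nil; apply => n.
  by rewrite big1 ?ler01 // => i _; rewrite powR0 // gt_eqF.
have [->|C0] := eqVneq (psum ga m) 0.
  by rewrite powR0 ?mulr0 // mulf_neq0 ?invr_eq0 ?gt_eqF //; lra.
have Cp : 0 < psum ga m by rewrite lt_neqAle eq_sym C0 sumr_ge0.
pose w v := if (v <= m)%N then (ga v / psum ga m) `^ p^-1 else 0.
have w0 v : 0 <= w v by rewrite /w; case: ifP => _ //; exact: powR_ge0.
have wp n : \sum_(0 <= v < n) w v `^ p <= 1.
  have E v : w v `^ p = if (v <= m)%N then ga v / psum ga m else 0.
    rewrite /w; case: ifP => _; last by rewrite powR0 // gt_eqF.
    by rewrite -powRrM mulVf ?gt_eqF // powRr1 // divr_ge0 // ltW.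
  under eq_bigr => v _ do rewrite E.
  rewrite -big_mkcond -mulr_suml ler_pdivrMr // mul1r /psum.
  have [nm|mn] := leqP n m.+1.
    rewrite [leRHS](@big_cat_nat _ _ _ n) //= big_mkcond /= -[leLHS]addr0.
    apply: lerD; last exact: sumr_ge0.
    by apply: ler_sum => v _; case: ifP.
  rewrite (@big_cat_nat _ _ _ m.+1) //=; last exact: ltnW.
  rewrite [X in _ + X]big_nat_cond [X in _ + X]big1 ?addr0; last first.
    by move=> v /andP[/andP[mv _]]; rewrite leqNgt mv.
  by rewrite big_mkcond /=; apply: ler_sum => v _; case: ifP.
apply: le_trans (HM w w0 wp N).
have [Nm|mN] := leqP N m.
  rewrite big_geq ?mul0r; last by rewrite (leq_trans Nm).
  by apply: sumr_ge0 => i _; exact: powR_ge0.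
rewrite [leRHS](@big_cat_nat _ _ _ m.+1) //= -[leLHS]add0r.
apply: lerD; first by apply: sumr_ge0 => i _; exact: powR_ge0.
rewrite mulr_suml; apply: ler_sum_nat => i /andP[mi _].
rewrite [s / p']mulrC powRrM -powRM ?powR_ge0 //.
apply: ler_powR_base; [exact: ltW|by rewrite mulr_ge0 ?powR_ge0|].
apply: ler_wpM2l => //.
rewrite (@big_cat_nat _ _ _ m.+1) //= -[leLHS]addr0.
apply: lerD; last by apply: sumr_ge0 => v _; exact: mulr_ge0.
have -> : psum ga m `^ p'^-1 = psum ga m / psum ga m `^ p^-1.
  rewrite -[X in _ = X / _]powRr1 ?ltW // -powRN -powRD ?C0 ?implybT //.
  by congr (_ `^ _); move: pp'; lra.
rewrite {1}/psum mulr_suml.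
apply: ler_sum_nat => v /andP[_ vm].
have iC : (psum ga m)^-1 `^ p^-1 = (psum ga m `^ p^-1)^-1.
  by rewrite -(powR_inv1 (ltW Cp)) -powRrM mulN1r powRN.
rewrite /w -ltnS vm powRM ?invr_ge0 ?(ltW Cp) // mulrA iC.
apply: ler_wpM2r; first by rewrite invr_ge0 powR_ge0.
rewrite /ga; have [->|cv] := eqVneq (c v) 0.
  by rewrite normr0 powR0 ?mul0r // gt_eqF //; lra.
rewrite -powRrM -{2}[`|c v|]powRr1 // -powRD ?normr_eq0 ?cv ?implybT //.
rewrite (_ : 1 + _ = p') //.
have -> : p' / p = p' - 1; last by ring.
by apply: (@mulIf _ p); rewrite ?mulfVK ?gt_eqF //; lra.
Qed.

(** Once [e] is known to be bounded, the diagonal part maps [l^p] into [l^s] by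
itself, hence so does the triangular part as a difference. *)
Theorem factorable_matrix :
  maps_lp_to_ls (fun x i => e i * x i + b i * \sum_(0 <= v < i) c v * x v)
  <-> (exists C, forall i, e i <= C) /\ hardy_bound.
Proof.
split=> [T|[[C eC] H] x xp].
  have [C eC] := diagonal_necessary T; split; first by exists C.
  apply: hardy_necessary => x xp.
  have H1 := T x xp; have H2 := diagonal_bounded eC xp.
  apply: bounded_sums_le (powR_ge0 2 s) _ H1 H2 => i.
  rewrite -[`|e i * x i|]normrN.
  apply: le_trans (normD_powR_le _ _ (ltW s_gt0)).
  by rewrite addrAC subrr add0r.
apply: bounded_sums_le (powR_ge0 2 s) _ (diagonal_bounded eC xp)
  (hardy_bounded H xp) => i.
exact: normD_powR_le (ltW s_gt0).
Qed.

End FactorableMatrix.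

(** * Weighted means in terms of Cesaro means *)

Section WeightedMeans.
Variables (R : realType) (q : nat -> R).
Hypothesis q_gt0 : forall n, 0 < q n.

Lemma psum_gt0 n : 0 < psum q n.
Proof.
rewrite /psum big_nat_recr //=; apply: ltr_wpDl => //.
by apply: sumr_ge0 => i _; exact: ltW.
Qed.

Lemma psumS (u : nat -> R) n : psum u n.+1 = psum u n + u n.+1.
Proof. by rewrite /psum big_nat_recr. Qed.

(** Summation by parts writes the mean as [psum a m - X m / psum q m], where [X]
is the sum on the right, and [psum a] and [X] have proportional increments. *)
Lemma wmean_diff (a : nat -> R) n :
  wmean q a n.+1 - wmean q a n =
  q n.+1 / (psum q n.+1 * psum q n) * \sum_(0 <= v < n.+1) psum q v * a v.+1.
Proof.
have Q0 m : psum q m != 0 by rewrite gt_eqF // psum_gt0.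
pose X m := \sum_(0 <= v < m) psum q v * a v.+1.
have XS m : X m.+1 = X m + psum q m * a m.+1 by rewrite /X big_nat_recr.
have E m : wmean q a m = psum a m - X m / psum q m.
  have P : \sum_(0 <= i < m.+1) q i * psum a i = psum q m * psum a m - X m.
    elim: m => [|m IH]; first by rewrite /psum /X !big_nat1 big_nil subr0.
    by rewrite big_nat_recr //= IH XS !psumS; ring.
  by rewrite /wmean P; field.
rewrite !E -/(X n.+1) XS; have := Q0 n.+1; rewrite !psumS => Qn1.
by field; rewrite Qn1 Q0.
Qed.

(** The hypothesis inverts the relation between a series and the increments [D]
of its Cesaro means; at [n = 0] the junk value [D 0.-1] has coefficient 0. *)
Lemma psum_mul_cesaro (a D : nat -> R) :
  (forall n, a n.+1 = n.+2%:R * D n - n%:R * D n.-1) ->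
  forall n, \sum_(0 <= v < n.+1) psum q v * a v.+1 =
    n.+2%:R * psum q n * D n +
    \sum_(0 <= v < n) (psum q v.+1 - v.+2%:R * q v.+1) * D v.
Proof.
move=> aD; elim=> [|n IH].
  by rewrite big_nat1 big_nil aD mul0r subr0 addr0; ring.
rewrite big_nat_recr //= IH [in RHS]big_nat_recr //= aD psumS.
by rewrite -!natr1 /=; ring.
Qed.

End WeightedMeans.

Definition cesaro_diff (R : realType) (a : nat -> R) n :=
  wmean (fun=> 1) a n.+1 - wmean (fun=> 1) a n.

Lemma psum1 (R : realType) n : psum (fun=> 1) n = n.+1%:R :> R.
Proof. by rewrite /psum sumr_const_nat subn0. Qed.

(** The case [q = 1] of [wmean_diff]. *)
Lemma cesaro_diffE (R : realType) (a : nat -> R) n :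
  n.+1%:R * n.+2%:R * cesaro_diff a n = \sum_(0 <= v < n.+1) v.+1%:R * a v.+1.
Proof.
rewrite /cesaro_diff wmean_diff // !psum1.
under eq_bigr => v _ do rewrite psum1.
by rewrite mul1r mulrA [_ * n.+2%:R]mulrC divff ?mul1r.
Qed.

Lemma term_cesaro_diff (R : realType) (a : nat -> R) n :
  a n.+1 = n.+2%:R * cesaro_diff a n - n%:R * cesaro_diff a n.-1.
Proof.
have n0 : n.+1%:R != 0 :> R by rewrite pnatr_eq0.
apply: (mulfI n0); rewrite mulrBr !mulrA cesaro_diffE big_nat_recr //=.
case: n n0 => [|n] n0; first by rewrite big_nil mulr0 mul0r subr0 add0r.
by rewrite /= [n.+2%:R * n.+1%:R]mulrC cesaro_diffE addrAC subrr add0r.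
Qed.

(** This surjectivity lets the matrix be tested on arbitrary sequences. The
series is the one of [term_cesaro_diff]; for [q = 1] the second sum in
[psum_mul_cesaro] vanishes identically. *)
Lemma cesaro_diff_surj (R : realType) (D : nat -> R) :
  exists a, forall n, cesaro_diff a n = D n.
Proof.
pose a n : R := if n is m.+1 then m.+2%:R * D m - m%:R * D m.-1 else 0.
exists a => n.
have := @psum_mul_cesaro _ (fun=> 1) a D (fun=> erefl) n.
rewrite [X in _ + X]big1 ?addr0; last first.
  by move=> v _; rewrite psum1 mulr1 subrr mul0r.
under eq_bigr => v _ do rewrite psum1.
rewrite psum1 -cesaro_diffE [n.+2%:R * _]mulrC; apply: mulfI.
by rewrite mulf_neq0 // pnatr_eq0.
Qed.

Lemma wmean_diff_cesaro (R : realType) (q a : nat -> R) n :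
  (forall i, 0 < q i) ->
  wmean q a n.+1 - wmean q a n =
  n.+2%:R * q n.+1 / psum q n.+1 * cesaro_diff a n +
  q n.+1 / (psum q n.+1 * psum q n) *
    \sum_(0 <= v < n) (psum q v.+1 - v.+2%:R * q v.+1) * cesaro_diff a v.
Proof.
move=> q0.
rewrite wmean_diff // (psum_mul_cesaro _ (term_cesaro_diff a)) mulrDr.
by congr (_ + _); field; rewrite !gt_eqF ?psum_gt0.
Qed.

(** * From summability methods to the matrix *)

Lemma nneseries_ltyP (R : realType) (u : nat -> R) m : (forall n, 0 <= u n) ->
  (\sum_(m <= n <oo) (u n)%:E < +oo)%E <->
  exists M, forall N, \sum_(m <= n < N) u n <= M.
Proof.
move=> u0.
have u0' n : (m <= n)%N -> true -> (0 <= (u n)%:E)%E by rewrite lee_fin.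
split=> [lty|[M HM]].
  have fin : (\sum_(m <= n <oo) (u n)%:E)%E \is a fin_num.
    by rewrite ge0_fin_numE // nneseries_ge0.
  exists (fine (\sum_(m <= n <oo) (u n)%:E)%E) => N.
  by rewrite -lee_fin fineK // -sumEFin; exact: nneseries_lim_ge.
apply: (@le_lt_trans _ _ M%:E); last exact: ltry.
apply: lime_le; first exact: is_cvg_nneseries.
by apply: nearW => N; rewrite sumEFin lee_fin.
Qed.

(** Moves the weight inside the power, so that absolute summability becomes
membership of a weighted difference in [l^s]. *)
Lemma powR_weight (R : realType) (s x y : R) : 1 < s -> 0 <= x ->
  x `^ (s - 1) * `|y| `^ s = `|x `^ (1 - s^-1) * y| `^ s.
Proof.
move=> s1 x0; rewrite normrM (ger0_norm (powR_ge0 _ _)) powRM ?powR_ge0 //.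
by rewrite -powRrM mulrBl mul1r mulVf // gt_eqF //; lra.
Qed.

Lemma wmean_summableP (R : realType) (q a : nat -> R) (s : R) : 1 < s ->
  wmean_summable q s a <-> bounded_sums (fun n =>
    `|n.+1%:R `^ (1 - s^-1) * (wmean q a n.+1 - wmean q a n)| `^ s).
Proof.
move=> s1; rewrite /wmean_summable nneseries_ltyP; last first.
  by move=> n; apply: mulr_ge0; exact: powR_ge0.
have E N : \sum_(1 <= n < N.+1)
      n%:R `^ (s - 1) * `|wmean q a n - wmean q a n.-1| `^ s =
    \sum_(0 <= n < N)
      `|n.+1%:R `^ (1 - s^-1) * (wmean q a n.+1 - wmean q a n)| `^ s.
  rewrite big_add1; apply: eq_bigr => n _.
  by rewrite powR_weight.
split=> -[M HM]; exists M => N; first by rewrite -E.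
case: N => [|N]; last by rewrite E.
by have := HM 0%N; rewrite big_nil big_geq.
Qed.

Section Translation.
Variables (R : realType) (q : nat -> R) (k s kstar : R).
Hypotheses (q_gt0 : forall n, 0 < q n) (k_gt1 : 1 < k) (k_le_s : k <= s).
Hypothesis k_conj : k^-1 + kstar^-1 = 1.

Let s_gt1 : 1 < s.
Proof. by move: k_gt1 k_le_s; lra. Qed.

Definition weight n : R := n.+1%:R.

Let weight_gt0 n : 0 < weight n.
Proof. by rewrite ltr0n. Qed.

(** The three sequences describe the matrix that sends
[n^(1 - 1/k) * (increment of the Cesaro mean)] to
[n^(1 - 1/s) * (increment of the weighted mean)]; see [wmean_diff_matrix]. *)
Definition diag_factor n :=
  weight n `^ (1 - s^-1) * (n.+2%:R * q n.+1 / psum q n.+1) /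
    weight n `^ (1 - k^-1).

Definition row_factor n :=
  weight n `^ (1 - s^-1) * q n.+1 / (psum q n.+1 * psum q n).

Definition col_factor v :=
  (psum q v.+1 - v.+2%:R * q v.+1) / weight v `^ (1 - k^-1).

Lemma diag_factor_ge0 n : 0 <= diag_factor n.
Proof.
rewrite divr_ge0 ?powR_ge0 // mulr_ge0 ?powR_ge0 // divr_ge0 ?mulr_ge0 //.
  exact: ltW.
by rewrite ltW // psum_gt0.
Qed.

Lemma row_factor_ge0 n : 0 <= row_factor n.
Proof.
by rewrite divr_ge0 ?mulr_ge0 ?powR_ge0 // ltW // psum_gt0.
Qed.

Let weight_powR_neq0 n r : weight n `^ r != 0.
Proof. by rewrite gt_eqF // powR_gt0. Qed.

Lemma wmean_diff_matrix (a : nat -> R) n :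
  let x i := weight i `^ (1 - k^-1) * cesaro_diff a i in
  weight n `^ (1 - s^-1) * (wmean q a n.+1 - wmean q a n) =
  diag_factor n * x n + row_factor n * \sum_(0 <= v < n) col_factor v * x v.
Proof.
move=> x; rewrite wmean_diff_cesaro // mulrDr; congr (_ + _).
  rewrite /diag_factor /x; field.
  by rewrite weight_powR_neq0 gt_eqF // psum_gt0.
rewrite /row_factor !mulrA; congr (_ * _); apply: eq_bigr => v _.
by rewrite /col_factor /x; field; rewrite weight_powR_neq0.
Qed.

Lemma summability_impliesP :
  summability_implies (cesaro_summable k) (wmean_summable q s) <->
  maps_lp_to_ls k s (fun x i =>
    diag_factor i * x i + row_factor i * \sum_(0 <= v < i) col_factor v * x v).
Proof.
split=> [T x xk|T a /(wmean_summableP _ _ k_gt1) xk].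
  have [a aD] := cesaro_diff_surj (fun n => x n / weight n `^ (1 - k^-1)).
  have xE i : weight i `^ (1 - k^-1) * cesaro_diff a i = x i.
    by rewrite aD mulrC divfK.
  have /T /(wmean_summableP _ _ s_gt1) : cesaro_summable k a.
    apply/wmean_summableP => //; case: xk => M HM; exists M => N.
    by under eq_bigr => i _ do rewrite -/(cesaro_diff a i) xE.
  move=> [M HM]; exists M => N; apply: le_trans (HM N).
  apply: ler_sum => i _; rewrite wmean_diff_matrix xE.
  by under [X in _ <= `|_ + _ * X| `^ _]eq_bigr => v _ do rewrite xE.
apply/wmean_summableP => //.
have [M HM] := T _ xk; exists M => N; apply: le_trans (HM N).
by apply: ler_sum => i _; rewrite wmean_diff_matrix.
Qed.

(** The two quantities differ by the factor [(n + 1) / n], which lies between 1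
and 2. *)
Lemma diagonal_boundP :
  (exists C : R, forall n, (1 <= n)%N ->
     n%:R `^ (1 + k^-1 - s^-1) * q n / psum q n <= C) <->
  (exists C, forall i, diag_factor i <= C).
Proof.
pose E n := weight n `^ (1 + k^-1 - s^-1) * q n.+1 / psum q n.+1.
have E0 n : 0 <= E n by rewrite divr_ge0 ?mulr_ge0 ?powR_ge0 // ltW // psum_gt0.
have eE n : diag_factor n = n.+2%:R / weight n * E n.
  have -> : E n = weight n * (weight n `^ (1 - s^-1) / weight n `^ (1 - k^-1)) *
      q n.+1 / psum q n.+1.
    have WN0 : weight n != 0 by rewrite gt_eqF.
    rewrite -powRN -powRD ?WN0 ?implybT // -[X in X * _ `^ _]powRr1 ?ltW //.
    rewrite -powRD ?WN0 ?implybT // /E; congr (_ `^ _ * _ / _); ring.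
  by rewrite /diag_factor; field; rewrite weight_powR_neq0 !gt_eqF // psum_gt0.
have r1 n : 1 <= n.+2%:R / weight n by rewrite ler_pdivlMr // mul1r ler_nat.
have r2 n : n.+2%:R / weight n <= 2.
  by rewrite ler_pdivrMr // /weight -!natr1; have := ler0n R n; lra.
split=> -[C HC].
  exists (2 * C) => i; rewrite eE; apply: ler_pM => //; last exact: HC.
  by apply: le_trans (r1 i).
exists C => -[|n] // _; apply: le_trans (HC n); rewrite eE.
by rewrite -[leLHS]mul1r; apply: ler_wpM2r; [exact: E0|].
Qed.

Lemma wmean_diff_delta1 (p : nat -> R) n : (forall i, 0 < p i) ->
  wmean p (fun i => (i == 1)%:R) n.+1 - wmean p (fun i => (i == 1)%:R) n =
  p n.+1 / (psum p n.+1 * psum p n) * p 0%N.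
Proof.
move=> p0; rewrite wmean_diff // big_nat_recl //= mulr1 big1 ?addr0.
  by rewrite /psum big_nat1.
by move=> v _; rewrite mulr0.
Qed.

(** The increments are [1 / (n (n + 1))], and the weighted powers are bounded by
these same increments, which telescope. *)
Lemma cesaro_summable_delta1 : cesaro_summable k (fun i => (i == 1)%:R : R).
Proof.
apply/wmean_summableP => //; exists 1 => N.
apply: (@le_trans _ _
  (\sum_(0 <= n < N) ((weight n)^-1 - (weight n.+1)^-1))); last first.
  rewrite -[leLHS]opprK -sumrN.
  under eq_bigr => n _ do rewrite opprB.
  by rewrite telescope_sumr // opprB /weight invr1 gerBl invr_ge0.
apply: ler_sum => n _; rewrite -powR_weight //.
rewrite wmean_diff_delta1 // !psum1 mulr1 mul1r.
set z := (_ * _)^-1.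
have z0 : 0 <= z by rewrite invr_ge0 mulr_ge0.
have -> : (weight n)^-1 - (weight n.+1)^-1 = z.
  have WS : weight n.+1 = weight n + 1 by rewrite /weight natr1.
  have [Wn WSn] : weight n != 0 /\ weight n + 1 != 0 by rewrite -WS !gt_eqF.
  rewrite /z -/(weight n.+1) -/(weight n) WS.
  by move: (weight n) Wn WSn => x *; field; apply/andP.
rewrite (ger0_norm z0) -(mulr_powRB1 z0 (p := k)); last by move: k_gt1; lra.
rewrite mulrCA -powRM //.
rewrite -[leRHS]mulr1; apply: ler_wpM2l => //.
rewrite -[leRHS](powRr0 (weight n * z)).
apply: ger_powR; last by move: k_gt1; lra.
rewrite /z invfM mulrCA mulfV ?mulr1 ?gt_eqF // invr_gt0 ltr0n /=.
by rewrite invf_le1 ?ltr0n // ler1n.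
Qed.

Definition tail_term n : R :=
  (n%:R `^ (1 - s^-1) * q n / (psum q n * psum q n.-1)) `^ s.

Let tail_term_ge0 n : 0 <= tail_term n.
Proof. exact: powR_ge0. Qed.

Lemma tail_partial_sum m N :
  \sum_(m.+2 <= n < N.+1) tail_term n = \sum_(m.+1 <= i < N) row_factor i `^ s.
Proof. by rewrite big_add1. Qed.

(** For the series with single term [a_1 = 1] the weighted increments are
[q 0 * row_factor n], whose [s]-th powers make up the tail. *)
Lemma wmean_tail_lty m :
  summability_implies (cesaro_summable k) (wmean_summable q s) ->
  (wmean_tail q s m.+1 < +oo)%E.
Proof.
move=> /(_ _ cesaro_summable_delta1) /(wmean_summableP _ _ s_gt1) [M HM].
apply/(nneseries_ltyP _ tail_term_ge0); exists (M / q 0%N `^ s) => N.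
have q0s : 0 < q 0%N `^ s by rewrite powR_gt0.
rewrite ler_pdivlMr //.
apply: le_trans (HM N); case: N => [|N].
  by rewrite big_geq // mul0r big_nil.
rewrite tail_partial_sum mulr_suml.
apply: (@le_trans _ _ (\sum_(0 <= i < N) row_factor i `^ s * q 0%N `^ s)).
  have [Nm|mN] := leqP N m.+1.
    by rewrite big_geq // sumr_ge0 // => i _; rewrite mulr_ge0 ?powR_ge0.
  rewrite [leRHS](@big_cat_nat _ _ _ m.+1) //=; last exact: ltnW.
  by rewrite lerDr sumr_ge0 // => i _; rewrite mulr_ge0 ?powR_ge0.
rewrite [leRHS]big_nat_recr //= -[leLHS]addr0.
apply: lerD; last exact: powR_ge0.
apply: ler_sum => i _.
rewrite wmean_diff_delta1 // -powRM ?row_factor_ge0 //; last exact: ltW.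
rewrite !mulrA -/(row_factor i) ger0_norm //.
by apply: mulr_ge0; [exact: row_factor_ge0|exact: ltW].
Qed.

Lemma hardy_sumE m :
  \sum_(1 <= v < m.+2) `|psum q v - v.+1%:R * q v| `^ kstar * v%:R^-1 =
  psum (fun v => `|col_factor v| `^ kstar) m.
Proof.
have [ks1 _ _] := conjugate_exponents k_gt1 k_conj.
rewrite /psum big_add1; apply: eq_bigr => v _.
rewrite /col_factor normrM normfV (ger0_norm (powR_ge0 _ _)).
rewrite powRM ?invr_ge0 ?powR_ge0 //.
rewrite -(powR_inv1 (powR_ge0 _ _)) -!powRrM.
rewrite (_ : _ * (_ * kstar) = -1) ?powR_inv1 ?ltW //.
have -> : 1 - k^-1 = kstar^-1 by move: k_conj; lra.
by rewrite mulN1r mulrN mulVf // gt_eqF //; lra.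
Qed.

(** Taking [s]-th powers removes the outer roots, and the extended real tail is
the supremum of the finite sums in [hardy_bound]. *)
Lemma hardy_boundP : (forall m, (wmean_tail q s m.+1 < +oo)%E) ->
  hardy_bound kstar s row_factor col_factor <->
  (exists C : R, forall m : nat, (1 <= m)%N ->
     (wmean_tail q s m `^ s^-1 *
      ((\sum_(1 <= v < m.+1)
          `|psum q v - v.+1%:R * q v| `^ kstar * v%:R^-1) `^ kstar^-1)%:E
      <= C%:E)%E).
Proof.
move=> tail_fin.
have sN0 : s != 0 by rewrite gt_eqF //; move: s_gt1; lra.
pose r m := fine (wmean_tail q s m.+1).
have tail0 m : (0 <= wmean_tail q s m.+1)%E.
  by apply: nneseries_ge0 => n _ _; rewrite lee_fin powR_ge0.
have rE m : wmean_tail q s m.+1 = (r m)%:E by rewrite /r fineK // ge0_fin_numE.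
have r0 m : 0 <= r m by rewrite -lee_fin -rE.
pose X m := psum (fun v => `|col_factor v| `^ kstar) m.
have X0 m : 0 <= X m by rewrite sumr_ge0 // => v _; exact: powR_ge0.
have part m N : \sum_(m.+1 <= i < N) row_factor i `^ s <= r m.
  rewrite -tail_partial_sum -lee_fin -rE -sumEFin.
  by apply: nneseries_lim_ge => n _ _; rewrite lee_fin powR_ge0.
have rX m : (r m `^ s^-1 * X m `^ kstar^-1) `^ s = r m * X m `^ (s / kstar).
  rewrite powRM ?powR_ge0 // -!powRrM mulVf // powRr1 //.
  by rewrite [kstar^-1 * _]mulrC.
have termE m : (wmean_tail q s m.+1 `^ s^-1 *
      ((\sum_(1 <= v < m.+2)
          `|psum q v - v.+1%:R * q v| `^ kstar * v%:R^-1) `^ kstar^-1)%:E)%E =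
    (r m `^ s^-1 * X m `^ kstar^-1)%:E.
  by rewrite hardy_sumE rE poweR_EFin EFinM.
split=> [[K HK]|[C HC]].
  exists (K `^ s^-1) => -[|m] // _; rewrite termE lee_fin.
  have rXK : r m * X m `^ (s / kstar) <= K.
    have [XZ|XN] := eqVneq (X m `^ (s / kstar)) 0.
      by rewrite XZ mulr0; have := HK m 0%N; rewrite big_geq // mul0r.
    have Xp : 0 < X m `^ (s / kstar) by rewrite lt_neqAle eq_sym XN powR_ge0.
    rewrite -ler_pdivlMr // -lee_fin -rE.
    apply: lime_le.
      by apply: is_cvg_nneseries => n _ _; rewrite lee_fin powR_ge0.
    apply: nearW => -[|N]; last first.
      by rewrite sumEFin lee_fin tail_partial_sum ler_pdivlMr.
    rewrite big_geq // lee_fin ler_pdivlMr // mul0r.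
    by have := HK m 0%N; rewrite big_geq // mul0r.
  have a0 : 0 <= r m `^ s^-1 * X m `^ kstar^-1 by rewrite mulr_ge0 ?powR_ge0.
  rewrite -(powRr1 a0) -(mulfV sN0) powRrM rX; apply: ler_powR_base.
  - by rewrite invr_ge0; move: s_gt1; lra.
  - by rewrite mulr_ge0 ?powR_ge0.
  - exact: rXK.
exists (C `^ s) => m N.
apply: (@le_trans _ _ (r m * X m `^ (s / kstar))).
  by apply: ler_wpM2r; rewrite ?powR_ge0.
rewrite -rX; apply: ler_powR_base; first by move: s_gt1; lra.
  by rewrite mulr_ge0 ?powR_ge0.
by rewrite -lee_fin -termE; exact: HC.
Qed.

End Translation.

Theorem corollary1 (R : realType) (q : nat -> R) (k s kstar : R)
    (q_gt0 : forall n : nat, 0 < q n)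
    (k_gt1 : 1 < k) (k_le_s : k <= s)
    (k_conj : k^-1 + kstar^-1 = 1) :
  summability_implies (cesaro_summable k) (wmean_summable q s)
  <->
  (exists C : R, forall n : nat, (1 <= n)%N ->
     n%:R `^ (1 + k^-1 - s^-1) * q n / psum q n <= C)
  /\
  (exists C : R, forall m : nat, (1 <= m)%N ->
     (wmean_tail q s m < +oo)%E /\
     (wmean_tail q s m `^ s^-1 *
      ((\sum_(1 <= v < m.+1)
          `|psum q v - v.+1%:R * q v| `^ kstar * v%:R^-1) `^ kstar^-1)%:E
      <= C%:E)%E).
Proof.
have M := @factorable_matrix R k kstar s (diag_factor q k s) (row_factor q s)
  (col_factor q k) k_gt1 k_le_s k_conj (diag_factor_ge0 k s q_gt0)
  (row_factor_ge0 s q_gt0).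
have P := summability_impliesP q_gt0 k_gt1 k_le_s.
have Q := hardy_boundP (q := q) k_gt1 k_le_s k_conj.
rewrite (diagonal_boundP k s q_gt0); split=> [T|[H1 [C HC]]].
  have fin m := wmean_tail_lty q_gt0 k_gt1 k_le_s m T.
  have [H1 H2] := M.1 (P.1 T); split=> //.
  have [C HC] := (Q fin).1 H2.
  by exists C => -[|m] // _; split; [exact: fin|exact: HC].
apply/P/M; split=> //; apply/Q.
  by move=> m; have [] := HC m.+1 isT.
by exists C => m m1; have [] := HC m m1.
Qed.
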